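(* For all $a\in\mathbb{R}$ and $b>0$, the Lyapunov exponent of the affine Boole transformation $\varphi_{a,b}$ is $\ln(2)$. More precisely, for Lebesgue almost every $x_0\in\mathbb{R}$, we have $$\lim_{n\to\infty}\frac{1}{n}\sum_{k=0}^{n-1}\ln\big(|\varphi_{a,b}'(x_k)|\big)=\ln(2),$$ where $x_k:=\varphi_{a,b}^{(k)}(x_0)$ for every non-negative integer $k$, and $\varphi_{a,b}^{(k)}$ denotes the $k$-fold iteration of $\varphi_{a,b}$, with the convention $\varphi_{a,b}^{(0)}(x):=x$, $x\in\mathbb{R}$.
   Context: For $a\in\mathbb{R}$ and $b>0$, the affine Boole transformation $\varphi_{a,b}:\mathbb{R}\to\mathbb{R}$ is defined by $$\varphi_{a,b}(x):=\begin{cases}\frac{b}{2}\left(\frac{x-a}{b}-\frac{1}{\frac{x-a}{b}}\right)+a=\frac{x}{2}+\frac{a}{2}-\frac{b^2/2}{x-a} & \text{if } x\neq a,\\ a & \text{if } x=a.\end{cases}$$ Lyapunov exponent: let $g:\mathbb{R}\to\mathbb{R}$ be a function which is differentiable Lebesgue almost everywhere, and for each non-negative integer $k$ let $g^{(k)}$ be the $k$-fold iteration of $g$ (with $g^{(0)}(x):=x$). Let $x_0\in\mathbb{R}$ be such that $g'(x_k)$ is well-defined and nonzero for each non-negative integer $k$, where $x_k:=g^{(k)}(x_0)$ and $g'(x_k)$ denotes the derivative of $g$ at $x_k$. Then the Lyapunov exponent of the orbit $(g^{(k)}(x_0))_{k\geq 0}$ is defined by $\lim_{n\to\infty}\frac1n\sum_{k=0}^{n-1}\ln(|g'(x_k)|)$,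 provided that the limit exists. *)

(* Defs.v *)
From HB Require Import structures.
From mathcomp Require Import all_boot all_order all_algebra.
From mathcomp Require Import all_classical all_reals all_analysis.

Set Implicit Arguments.
Unset Strict Implicit.
Unset Printing Implicit Defensive.

Import Order.TTheory GRing.Theory Num.Theory.
Import numFieldNormedType.Exports.

Local Open Scope classical_set_scope.
Local Open Scope ring_scope.

Definition affine_boole (R : realType) (a b x : R) : R :=
  if x == a then a
  else b / 2 * ((x - a) / b - 1 / ((x - a) / b)) + a.

Definition ae_differentiable (R : realType) (g : R -> R) : Prop :=
  {ae (@lebesgue_measure R), forall x : R, derivable g x 1}.

(* The library's derivative and logarithm are total functions, so the
   conditions under which the exponent is meaningful (g differentiable almost
   everywhere, and g' existing and nonzero along the orbit of x0) are part of
   the relation. *)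
Definition is_lyapunov_exponent (R : realType) (g : R -> R) (x0 l : R) : Prop :=
  [/\ ae_differentiable g,
      forall k : nat, derivable g (iter k g x0) 1 /\ derive1 g (iter k g x0) != 0
    & (n%:R^-1 * \sum_(0 <= k < n) ln `|derive1 g (iter k g x0)|)
        @[n --> \oo] --> l].

(* Main.v *)
Require Import Defs.
From HB Require Import structures.
From mathcomp Require Import all_boot all_order all_algebra.
From mathcomp Require Import all_classical all_reals all_analysis.
From mathcomp Require Import measurable_realfun ring lra.

Import Order.TTheory GRing.Theory Num.Theory.
Import numFieldNormedType.Exports.

Local Open Scope classical_set_scope.
Local Open Scope ring_scope.

(** Write [y = (x - a) / b].  In this coordinate the affine Boole map becomes
    [boole y = (y - 1 / y) / 2], which is the doubling formula
    [cot (2 t) = (cot t - 1 / cot t) / 2].  Two features of it give the theorem.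

    The derivative is a coboundary up to a constant: since
    [4 y^2 (1 + (boole y)^2) = (1 + y^2)^2],

      [boole' y = (1 + y^-2) / 2 = 2 (1 + (boole y)^2) / (1 + y^2)].

    The logarithms along an orbit [y_0, y_1, y_2] and so on therefore telescope
    ([sum_ln_derive_affine_boole]), and the n-th average is

      [ln 2 + (ln (1 + y_n^2) - ln (1 + y_0^2)) / n].

    It therefore suffices that almost every orbit avoids the singularity 0 and
    satisfies [ln (1 + y_n^2) = o(n)].

    Both facts follow from the invariance of the Cauchy measure, of density
    [1 / (1 + y^2)], under [boole] ([cauchy_measure_boole]).  The set of points
    whose orbit reaches 0 at time k has the measure of a point, namely zero.
    The set where [|y_n| > (n + 1) (n + 2)] has the measure of the tail
    [|y| > (n + 1) (n + 2)], which is at most [2 / ((n + 1) (n + 2))] and hence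
    summable, so by Borel-Cantelli almost every orbit eventually stays below
    this polynomial bound ([ae_iter_boole_growth]).  The density being positive,
    Cauchy-null sets are Lebesgue-null, and the affine change of variable
    preserves Lebesgue-null sets. *)

(** * The Boole map and its inverse branches *)

(** The convention [0^-1 = 0] makes 0 a fixed point, in agreement with the value
    of the affine Boole map at its singularity. *)
Definition boole {R : realType} (y : R) : R := (y - y^-1) / 2.

Section boole_algebra.
Context {R : realType}.
Implicit Types (a b x y u v : R) (k n : nat).

Lemma affine_booleE a b x : b != 0 ->
  affine_boole a b x = a + b * boole ((x - a) / b).
Proof.
move=> b0; rewrite /affine_boole /boole.
have [->|xa] := eqVneq x a; first by rewrite subrr mul0r invr0; field.
by have ? : x - a != 0; [rewrite subr_eq0 | field; apply/andP].
Qed.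

Lemma iter_affine_boole a b x k : b != 0 ->
  (iter k (affine_boole a b) x - a) / b = iter k boole ((x - a) / b).
Proof.
move=> b0; elim: k => [//|k IH]; rewrite !iterS affine_booleE// IH.
by field.
Qed.

Lemma oneDsqr_gt0 y : 0 < 1 + y ^+ 2.
Proof. by rewrite ltr_wpDr// sqr_ge0. Qed.

Lemma oneDsqr_neq0 y : 1 + y ^+ 2 != 0.
Proof. exact/lt0r_neq0/oneDsqr_gt0. Qed.

Lemma iter_affine_boole_neq a b x k : b != 0 ->
  iter k boole ((x - a) / b) != 0 -> iter k (affine_boole a b) x != a.
Proof.
move=> b0; rewrite -iter_affine_boole//.
by apply: contra_neq => ->; rewrite subrr mul0r.
Qed.

(** The usual formula is [(1 + y^-2) / 2]; this form exhibits the ratio of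
    consecutive values of [1 + y^2] that makes the sum along an orbit
    telescope. *)
Lemma is_derive_affine_boole a b x : b != 0 -> x != a ->
  is_derive x 1 (affine_boole a b)
    (2 * (1 + boole ((x - a) / b) ^+ 2) / (1 + ((x - a) / b) ^+ 2)).
Proof.
move=> b0 xa; have xa0 : x - a != 0 by rewrite subr_eq0.
have -> : affine_boole a b =
    (fun z => a + (b / 2) * ((z - a) * b^-1 - ((z - a) * b^-1)^-1)).
  by apply/funext => z; rewrite affine_booleE// /boole; congr (_ + _); ring.
have yb0 : (x - a) * b^-1 != 0 by rewrite mulf_neq0// invr_eq0.
have dy : is_derive x 1 (fun z : R => (z - a) * b^-1) b^-1.
  apply: is_derive_eq; rewrite !scaler0 add0r subr0 /GRing.scale/= ?mulr1.
  by [].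
have dV := @is_deriveV R (fun z => (z - a) * b^-1) x _ _ yb0 dy.
apply: is_derive_eq.
rewrite /GRing.scale/= /boole; set y := (x - a) / b in yb0 *.
have ? := oneDsqr_neq0 y.
field.
by apply/and3P.
Qed.

(** The equation [boole y = v] reads [y^2 - 2 v y - 1 = 0].  Its roots have
    product -1, so there is one on each side of 0. *)
Definition boole_inv_neg v : R := v - Num.sqrt (1 + v ^+ 2).
Definition boole_inv_pos v : R := v + Num.sqrt (1 + v ^+ 2).

Lemma boole_inv_bounds v : boole_inv_neg v < 0 < boole_inv_pos v.
Proof.
have h : `|v| < Num.sqrt (1 + v ^+ 2).
  by rewrite -sqrtr_sqr ltr_sqrt ?oneDsqr_gt0// ltrDr.
move: h; rewrite ltr_norml /boole_inv_neg /boole_inv_pos => /andP[h1 h2].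
by apply/andP; split; lra.
Qed.

Lemma boole_factor v y : y != 0 ->
  2 * y * (boole y - v) = (y - boole_inv_neg v) * (y - boole_inv_pos v).
Proof.
move=> y0; rewrite /boole_inv_neg /boole_inv_pos.
set r := Num.sqrt _.
have rr : r ^+ 2 = 1 + v ^+ 2 by rewrite sqr_sqrtr// ltW// oneDsqr_gt0.
transitivity (y ^+ 2 - 2 * v * y + v ^+ 2 - (1 + v ^+ 2)).
  by rewrite /boole; field.
by rewrite -rr; ring.
Qed.

(** By the factorization, [y] and [boole y - v] are linked by the sign of
    [(y - boole_inv_neg v) (y - boole_inv_pos v)], in which the factor of the
    other branch has a known sign. *)
Lemma boole_le v y : y != 0 ->
  (boole y <= v) = (y <= if 0 < y then boole_inv_pos v else boole_inv_neg v).
Proof.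
move=> yn0; have := boole_factor v _ yn0.
have /andP[s0 t0] := boole_inv_bounds v.
move: yn0; rewrite neq_lt => /orP[y0|y0] E.
- rewrite ltNge (ltW y0)/=; apply/idP/idP => h.
  + by rewrite leNgt; apply/negP => sy; nra.
  + by rewrite leNgt; apply/negP => vy; nra.
- rewrite y0; apply/idP/idP => h.
  + by rewrite leNgt; apply/negP => sy; nra.
  + by rewrite leNgt; apply/negP => vy; nra.
Qed.

(** The point 0 is removed because its image is conventional. *)
Lemma boole_preimage_itvoc u v : u <= v ->
  (boole @^-1` `]u, v]) `\ 0 =
  `]boole_inv_neg u, boole_inv_neg v] `|` `]boole_inv_pos u, boole_inv_pos v].
Proof.
move=> uv.
have /andP[su0 tu0] := boole_inv_bounds u.
have /andP[sv0 tv0] := boole_inv_bounds v.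
apply/seteqP; split => y /=; rewrite !in_itv/=.
- move=> [/andP[uy yv] /eqP yn0]; move: uy yv.
  rewrite ltNge !boole_le// -ltNge.
  by case: ifPn => _ h1 h2; [right|left]; apply/andP.
- move=> H; have yn0 : y != 0.
    by case: H => /andP[h1 h2]; [rewrite lt_eqF//|rewrite gt_eqF//]; lra.
  split; last exact/eqP.
  rewrite ltNge !boole_le// -ltNge.
  by case: H => /andP[h1 h2]; case: ifPn => h3; apply/andP; split => //; lra.
Qed.

End boole_algebra.

(** * Image measures on the line *)

(** Half-open intervals are stable under intersection and generate the Borel
    sets, so they determine an image measure. *)
Lemma measure_preimage_itvoc {R : realType}
    (m n : {measure set (measurableTypeR R) -> \bar R})
    (f : measurableTypeR R -> measurableTypeR R) :
  measurable_fun setT f ->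
  (forall u v : R, u <= v -> m (f @^-1` `]u, v]) = n `]u, v]%classic) ->
  (forall u v : R, u <= v -> (n `]u, v]%classic < +oo)%E) ->
  forall A, measurable A -> m (f @^-1` A) = n A.
Proof.
move=> mf mn fin A mA.
pose fm := measure_function_pushforward__canonical__measure_function_Measure m mf.
suff : n A = fm A by [].
apply: (@measure_unique _ R (measurableTypeR R) (@ocitv R)
    (fun k => `](- k%:R), k%:R]%classic)) => //.
- exact: ocitvI.
- by move=> k; exact: is_ocitv.
- apply/seteqP; split => // x _.
  exists (Num.truncn `|x|).+1 => //=; rewrite in_itv/=.
  by have := Num.Theory.truncnS_gt `|x|; rewrite ltr_norml => /andP[-> /ltW].
- move=> _ [[u v]] _ <- /=; have [uv|vu] := leP u v; first exact/esym/mn.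
  by rewrite set_itv_ge ?measure0// bnd_simp -leNgt ltW.
- by move=> k; apply: fin; rewrite (@le_trans _ _ 0)// oppr_le0.
Qed.

Section affine_change.
Context {R : realType}.
Local Notation lambda := (@lebesgue_measure R).

(** An affine map multiplies the Lebesgue measure by a constant. *)
Lemma ae_affine (a b : R) (P : R -> Prop) : 0 < b ->
  {ae lambda, forall y : R, P y} -> {ae lambda, forall x : R, P ((x - a) / b)}.
Proof.
move=> b0 [N [mN N0 PN]].
pose A : measurableTypeR R -> measurableTypeR R := fun x => (x - a) / b.
have mA : measurable_fun setT A.
  by apply: measurable_funM => //; exact: measurable_funB.
have lE (u v : R) : u <= v -> lambda `]u, v] = (v - u)%:E.
  rewrite le_eqVlt => /predU1P[->|uv]; rewrite lebesgue_measure_itv/= lte_fin.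
    by rewrite ltxx subrr.
  by rewrite uv EFinB.
have bE (u v : R) : u <= v ->
    mscale (NngNum (ltW b0)) lambda `]u, v]%classic = (b * (v - u))%:E.
  by move=> uv; rewrite EFinM -lE.
have H : forall B, measurable B ->
    lambda (A @^-1` B) = mscale (NngNum (ltW b0)) lambda B.
  apply: measure_preimage_itvoc => // u v uv; last first.
    by rewrite [X in (X < _)%E]bE// ltry.
  have -> : A @^-1` `]u, v] = `](a + b * u), (a + b * v)]%classic :> set R.
    apply/seteqP; split=> x; rewrite /A/= !in_itv/= ltr_pdivlMr// ler_pdivrMr//;
      by rewrite ltrBrDl lerBlDl ![_ * b]mulrC.
  rewrite [RHS]bE// [LHS]lE ?lerD2l ?ler_pM2l//.
  by congr _%:E; ring.
exists (A @^-1` N); split.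
- by rewrite -[X in measurable X]setTI; exact: mA.
- by rewrite [LHS]H// /mscale/= N0 mule0.
- by move=> x /= nP; apply: PN.
Qed.

End affine_change.

(** * The Cauchy measure *)

Section cauchy_measure.
Context {R : realType}.
Local Notation lambda := (@lebesgue_measure R).

Definition cauchy_measure (A : set (measurableTypeR R)) : \bar R :=
  (\int[lambda]_(x in A) ((1 + x ^+ 2)^-1)%:E)%E.

Lemma continuous_cauchy_density :
  continuous (fun x : R => (1 + x ^+ 2)^-1).
Proof. exact: continuous_oneDsqrV. Qed.

Lemma measurable_cauchy_density :
  measurable_fun [set: R] (fun x : R => ((1 + x ^+ 2)^-1)%:E).
Proof.
apply/measurable_EFinP; apply: continuous_measurable_fun.
exact: continuous_cauchy_density.
Qed.

Let cauchy0 : cauchy_measure set0 = 0%E.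
Proof. exact: integral_set0. Qed.

Let cauchy_ge0 A : (0 <= cauchy_measure A)%E.
Proof.
by apply: integral_ge0 => x _; rewrite lee_fin invr_ge0 ltW// oneDsqr_gt0.
Qed.

Let cauchy_sigma_additive : semi_sigma_additive cauchy_measure.
Proof.
apply: semi_sigma_additive_nng_induced => [|x].
  exact: measurable_cauchy_density.
by rewrite lee_fin invr_ge0 ltW// oneDsqr_gt0.
Qed.

HB.instance Definition _ := isMeasure.Build _ _ _
  cauchy_measure cauchy0 cauchy_ge0 cauchy_sigma_additive.

Lemma cauchy_measure_set1 (x : R) : cauchy_measure [set x] = 0%E.
Proof. by rewrite /cauchy_measure integral_set1. Qed.

Lemma cauchy_measure_itvoc (u v : R) : u <= v ->
  cauchy_measure `]u, v] = (atan v - atan u)%:E.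
Proof.
rewrite le_eqVlt => /predU1P[->|uv].
  by rewrite set_itvoc0 subrr; exact: measure0.
rewrite /cauchy_measure integral_itv_obnd_cbnd; last first.
  exact: measurable_funTS measurable_cauchy_density.
rewrite (continuous_FTC2 uv (F := atan)) ?EFinB//.
- by apply: continuous_subspaceT; exact: continuous_cauchy_density.
- split=> [x _| |]; first exact: derivable_atan.
  + by apply: cvg_at_right_filter; exact: continuous_atan.
  + by apply: cvg_at_left_filter; exact: continuous_atan.
- by move=> x _; rewrite derive1_atan.
Qed.

(** The density vanishes nowhere. *)
Lemma cauchy_measure_null (A : set R) : measurable A ->
  cauchy_measure A = 0%E -> lambda A = 0%E.
Proof.
move=> mA A0.
have : ae_eq lambda A (fun x : R => ((1 + x ^+ 2)^-1)%:E) (cst 0%E).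
  apply/ae_eq_integral_abs => //.
    exact: measurable_funTS measurable_cauchy_density.
  rewrite -A0; apply: eq_integral => x _.
  by rewrite gee0_abs// lee_fin invr_ge0 ltW// oneDsqr_gt0.
move=> h; apply: measure_negligible => //; apply: negligibleS h => x Ax /= /(_ Ax).
by move=> [] /eqP; rewrite invr_eq0 (negbTE (oneDsqr_neq0 x)).
Qed.

Lemma negligible_cauchy_lebesgue (A : set R) :
  cauchy_measure.-negligible A -> lambda.-negligible A.
Proof.
by move=> [N [mN N0 AN]]; exists N; split => //; exact: cauchy_measure_null.
Qed.

(** [atan x + 1 / x] is nonincreasing on the positive half-line, because
    [1 / (1 + x^2) <= 1 / x^2]. *)
Lemma atan_tail (u v : R) : 0 < u -> u <= v -> atan v - atan u <= u^-1.
Proof.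
move=> u0 uv.
have v0 : 0 < v by exact: lt_le_trans uv.
have d (x : R) : 0 < x -> is_derive x 1 (fun x : R => atan x + x^-1)
    ((1 + x ^+ 2)^-1 - x ^- 2).
  move=> x0; have dV := @is_deriveV R id x 1 1 (lt0r_neq0 x0) (is_derive_id x 1).
  apply: is_derive_eq; rewrite /GRing.scale/= mulr1; by [].
suff : atan v + v^-1 <= atan u + u^-1.
  by have v'0 : 0 < v^-1; [rewrite invr_gt0 | lra].
have := @ler0_derive1_le_cc R (fun x => atan x + x^-1) u v.
move=> H; apply: H => //.
- move=> x; rewrite in_itv/= => /andP[ux _].
  by have [] := d x (lt_trans u0 ux).
- move=> x; rewrite in_itv/= => /andP[ux _]; rewrite derive1E.
  have x0 := lt_trans u0 ux; have dx := d x x0; rewrite derive_val.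
  by rewrite subr_le0 lef_pV2 ?posrE ?oneDsqr_gt0 ?exprn_gt0// lerDr.
- apply: derivable_within_continuous => x; rewrite in_itv/= => /andP[ux _].
  by have [] := d x (lt_le_trans u0 ux).
- by rewrite in_itv/= uv lexx.
- by rewrite in_itv/= lexx uv.
Qed.

Lemma measurable_norm_gt (M : R) :
  measurable ([set y : R | M < `|y|] : set (measurableTypeR R)).
Proof.
have -> : [set y : R | M < `|y|] = ~` `[- M, M].
  by apply/seteqP; split=> y /=; rewrite in_itv/= -ler_norml ltNge; move/negP.
exact: measurableC.
Qed.

Lemma cauchy_measure_tail (M : R) : 0 < M ->
  (cauchy_measure [set y : R | (M < `|y|)%R] <= (2 / M)%:E)%E.
Proof.
move=> M0.
(* The tail is the increasing union of the bounded sets [M < |y| <= M + k], up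
   to endpoints; each of them has measure [2 (atan (M + k) - atan M)]. *)
pose F (k : nat) : set (measurableTypeR R) :=
  `](- (M + k%:R)), (- M)] `|` `]M, (M + k%:R)].
have mF k : measurable (F k) by exact: measurableU.
have ndF : nondecreasing_seq F.
  move=> k l kl; apply/subsetPset => y; rewrite /F/= !in_itv/=.
  have : k%:R <= l%:R :> R by rewrite ler_nat.
  by move=> h [] /andP[h1 h2]; [left|right]; apply/andP; split; lra.
have mUF : measurable (\bigcup_k F k) by exact: bigcup_measurable.
have FE k : (cauchy_measure (F k) <= (2 / M)%:E)%E.
  apply: (@le_trans _ _ (cauchy_measure `](- (M + k%:R))%R, (- M)%R]
      + cauchy_measure `]M, (M + k%:R)%R])%E); first exact: measureU2.
  have k0 : 0 <= k%:R :> R by [].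
  rewrite !cauchy_measure_itvoc ?lerDl ?lerN2 ?lerDl// -EFinD lee_fin !atanN.
  have := @atan_tail M (M + k%:R) M0; rewrite lerDl => /(_ k0).
  lra.
apply: (@le_trans _ _ (cauchy_measure (\bigcup_k F k))).
  apply: le_measure; rewrite ?inE//; first exact: measurable_norm_gt.
  move=> y /= My; exists (Num.truncn `|y|).+1 => //; rewrite /F/= !in_itv/=.
  have := Num.Theory.truncnS_gt `|y|.
  move: My; case: (leP 0 y) => y0; [rewrite ger0_norm//|rewrite ltr0_norm//] => h1 h2.
    by right; apply/andP; split => //; lra.
  by left; apply/andP; split; lra.
rewrite -(cvg_lim _ (nondecreasing_cvg_mu mF mUF ndF))//.
apply: lime_le.
  by apply/cvg_ex; eexists; exact: (nondecreasing_cvg_mu mF mUF ndF).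
exact: nearW.
Qed.

End cauchy_measure.

(** * Invariance of the Cauchy measure *)

Section boole_invariance.
Context {R : realType}.
Implicit Types u v : R.

(** Each inverse branch halves the angle: for [v = tan s], the branch value is
    [(1 + sin s) / cos s = tan (s / 2 + pi / 4)].  The proof compares
    derivatives, both being [1 / (2 (1 + v^2))]. *)
Lemma atan_boole_inv_pos u v :
  atan (boole_inv_pos v) - atan (boole_inv_pos u) = (atan v - atan u) / 2.
Proof.
pose f v : R := atan (boole_inv_pos v) - atan v / 2.
suff : f v = f u by rewrite /f; lra.
apply: is_derive_0_is_cst => {u v} x.
have r0 := oneDsqr_gt0 x.
have ds := is_derive1_sqrt r0.
have dq : is_derive x 1 (fun x : R => 1 + x ^+ 2) (2 * x).
  by apply: is_derive_eq; rewrite /GRing.scale/=; ring.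
have dsq := @is_derive1_comp R Num.sqrt (fun x : R => 1 + x ^+ 2) x _ _ ds dq.
have dpos : is_derive x 1 (@boole_inv_pos R)
    (1 + (2 * Num.sqrt (1 + x ^+ 2))^-1 * (2 * x)) by exact: is_deriveD.
have datan := @is_derive1_comp R atan _ x _ _ (is_derive1_atan _) dpos.
have -> : f = (atan \o @boole_inv_pos R) - (2^-1 *: @atan R).
  by apply/funext => y; rewrite /f/= [X in _ - X]mulrC.
apply: is_derive_eq; rewrite /GRing.scale/= /boole_inv_pos.
have sp : 0 < Num.sqrt (1 + x ^+ 2) by rewrite sqrtr_gt0.
have /andP[_ p0] := boole_inv_bounds x.
move: p0; rewrite /boole_inv_pos.
have rr : Num.sqrt (1 + x ^+ 2) ^+ 2 = 1 + x ^+ 2 by rewrite sqr_sqrtr// ltW.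
move: rr sp; set r := Num.sqrt _ => rr sp p0.
have -> : 1 + (x + r) ^+ 2 = 2 * r * (x + r) by nra.
rewrite -rr; field.
by rewrite !lt0r_neq0.
Qed.

Lemma atan_boole_inv_neg u v :
  atan (boole_inv_neg v) - atan (boole_inv_neg u) = (atan v - atan u) / 2.
Proof.
have E w : boole_inv_neg w = - boole_inv_pos (- w).
  by rewrite /boole_inv_neg /boole_inv_pos sqrrN; ring.
rewrite !E !atanN; have := atan_boole_inv_pos (- v) (- u).
rewrite !atanN; lra.
Qed.

Lemma boole_inv_posK v : boole (boole_inv_pos v) = v.
Proof.
have /andP[_ /lt0r_neq0 p0] := boole_inv_bounds v.
apply/eqP; rewrite -subr_eq0 -(mulrI_eq0 _ (@mulfI _ (2 * boole_inv_pos v) _)).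
  by rewrite boole_factor// subrr mulr0.
by rewrite mulf_neq0.
Qed.

Lemma boole_inv_negK v : boole (boole_inv_neg v) = v.
Proof.
have /andP[/ltr0_neq0 n0 _] := boole_inv_bounds v.
apply/eqP; rewrite -subr_eq0 -(mulrI_eq0 _ (@mulfI _ (2 * boole_inv_neg v) _)).
  by rewrite boole_factor// subrr mul0r.
by rewrite mulf_neq0.
Qed.

Lemma boole_inv_pos_le u v : u <= v -> boole_inv_pos u <= boole_inv_pos v.
Proof.
have /andP[_ p0] := boole_inv_bounds u.
by rewrite -{1}(boole_inv_posK u) boole_le ?lt0r_neq0// p0.
Qed.

Lemma boole_inv_neg_le u v : u <= v -> boole_inv_neg u <= boole_inv_neg v.
Proof.
have /andP[n0 _] := boole_inv_bounds u.
by rewrite -{1}(boole_inv_negK u) boole_le ?ltr0_neq0// ltNge (ltW n0).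
Qed.

Lemma measurable_boole :
  measurable_fun setT (boole : measurableTypeR R -> measurableTypeR R).
Proof.
apply: (measurability (@ocitv R)) => //.
move=> _ [_ [[u v] _ <-] <-] /=; rewrite setTI.
have [uv|vu] := leP u v; last first.
  by rewrite set_itv_ge ?preimage_set0// bnd_simp -leNgt ltW.
have mD : measurable ((boole @^-1` `]u, v]) `\ 0 : set (measurableTypeR R)).
  by rewrite boole_preimage_itvoc//; exact: measurableU.
have [B0|B0] := pselect ((boole @^-1` `]u, v]) (0 : R)).
  by rewrite -(setD1K B0); exact: measurableU.
by rewrite -(not_setD1 B0).
Qed.

Lemma measurable_iter_boole n :
  measurable_fun setT (iter n boole : measurableTypeR R -> measurableTypeR R).
Proof.
elim: n => [|n IH]; first exact: measurable_id.
exact: measurableT_comp measurable_boole IH.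
Qed.

End boole_invariance.

(** * Almost every orbit of the Boole map *)

Section boole_orbits.
Context {R : realType}.
Local Notation lambda := (@lebesgue_measure R).
Local Notation nu := (@cauchy_measure R).

(** The preimage of a half-open interval consists of one interval for each inverse branch,
    and each of the two carries half of the mass. *)
Lemma cauchy_measure_boole (A : set (measurableTypeR R)) : measurable A ->
  nu (boole @^-1` A) = nu A.
Proof.
pose T : measurableTypeR R -> measurableTypeR R := boole.
have mT : measurable_fun setT T by exact: measurable_boole.
apply: measure_preimage_itvoc mT _ _ A => u v; last first.
  by move=> uv; rewrite [X in (X < _)%E]cauchy_measure_itvoc// ltry.
move=> uv; have /andP[su0 tu0] := boole_inv_bounds u.
have /andP[sv0 tv0] := boole_inv_bounds v.
have nuD : nu ((boole @^-1` `]u, v]) `\ 0) = nu `]u, v].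
  rewrite boole_preimage_itvoc// measureU//; last first.
    apply/seteqP; split=> // y [] /=; rewrite !in_itv/= => /andP[_ h1] /andP[h2 _].
    by have := lt_trans (le_lt_trans h1 sv0) (lt_trans tu0 h2); rewrite ltxx.
  rewrite [X in (X + _)%E]cauchy_measure_itvoc ?boole_inv_neg_le//.
  rewrite [X in (_ + X)%E]cauchy_measure_itvoc ?boole_inv_pos_le//.
  rewrite [RHS]cauchy_measure_itvoc// -EFinD; congr _%:E.
  by rewrite atan_boole_inv_neg atan_boole_inv_pos -splitr.
(* The point 0 may belong to the preimage, but it carries no mass. *)
transitivity (nu ((T @^-1` `]u, v]) `\ 0)); last exact: nuD.
have mD : measurable ((T @^-1` `]u, v]) `\ 0).
  by rewrite boole_preimage_itvoc//; exact: measurableU.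
have [B0|B0] := pselect ((T @^-1` `]u, v]) 0); last by rewrite (not_setD1 B0).
rewrite -{1}(setD1K B0) setUC measureU0//.
exact: cauchy_measure_set1.
Qed.

Lemma cauchy_measure_iter_boole n (A : set (measurableTypeR R)) :
  measurable A -> nu (iter n boole @^-1` A) = nu A.
Proof.
elim: n A => [//|n IH] A mA.
rewrite -[RHS]cauchy_measure_boole// -[RHS]IH.
  congr (nu _); apply/seteqP; split=> y /=; by rewrite -iterS.
by rewrite -[X in measurable X]setTI; exact: measurable_boole.
Qed.

Lemma ae_iter_boole_neq0 :
  {ae lambda, forall y : R, forall k, iter k boole y != 0}.
Proof.
apply: negligible_cauchy_lebesgue.
pose Z k : set (measurableTypeR R) := iter k boole @^-1` [set 0].
apply: (@negligibleS _ _ _ _ (\bigcup_k Z k)).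
  move=> y /= /existsNP[k /negP]; rewrite negbK => /eqP yk.
  by exists k.
apply: negligible_bigcup => k; apply/negligibleP.
  by rewrite -[X in measurable X]setTI; exact: measurable_iter_boole.
by rewrite [LHS]cauchy_measure_iter_boole// cauchy_measure_set1.
Qed.

(** Borel-Cantelli for the events that [|y_n|] exceeds a threshold.  By invariance
    their measures are tails of the Cauchy measure; the thresholds
    [(n + 1) (n + 2)] make the sum of the tail bounds telescope, and are
    polynomial, hence subexponential. *)
Lemma ae_iter_boole_growth :
  {ae lambda, forall y : R,
    \forall n \near \oo, `|iter n boole y| <= n.+1%:R * n.+2%:R}.
Proof.
apply: negligible_cauchy_lebesgue.
pose F n : set (measurableTypeR R) :=
  iter n boole @^-1` [set y : R | n.+1%:R * n.+2%:R < `|y|].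
have mF n : measurable (F n).
  rewrite -[X in measurable X]setTI; apply: measurable_iter_boole => //.
  exact: measurable_norm_gt.
exists (lim_sup_set F); split.
- by apply: bigcap_measurable => // n _; exact: bigcup_measurable.
- apply: lim_sup_set_cvg0 => //.
  apply: (@le_lt_trans _ _ 2%:E); last exact: ltry.
  apply: lime_le; first by apply: is_cvg_nneseries => *; exact: measure_ge0.
  apply: nearW => n.
  apply: (@le_trans _ _ (\sum_(0 <= k < n)
      (2 * (k.+1%:R^-1 - k.+2%:R^-1))%:E)%E).
    apply: lee_sum => k _.
    rewrite /F [X in (X <= _)%E]cauchy_measure_iter_boole; last first.
      exact: measurable_norm_gt.
    apply: le_trans (cauchy_measure_tail _ _) _; first by rewrite mulr_gt0.
    rewrite lee_fin le_eqVlt; apply/orP; left; apply/eqP.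
    rewrite -[k.+2]addn1 -[k.+1]addn1 !natrD.
    have k0 : 0 <= k%:R :> R by [].
    field; apply/andP; split; apply: lt0r_neq0; lra.
  rewrite sumEFin lee_fin -mulr_sumr.
  have -> : \sum_(0 <= k < n) (k.+1%:R^-1 - k.+2%:R^-1) = 1 - n.+1%:R^-1 :> R.
    have := @telescope_sumr R 0 n (fun k => - k.+1%:R^-1) (leq0n n).
    by under eq_bigr do rewrite opprK addrC; rewrite invr1 opprK addrC.
  by rewrite ler_piMr// lerBlDr lerDl invr_ge0.
- move=> y /= H n _; apply: contrapT => K; apply: H; exists n => //= k nk.
  by rewrite leNgt; apply/negP => h; apply: K; exists k.
Qed.

End boole_orbits.

(** * The Lyapunov exponent *)

Section lyapunov.
Context {R : realType}.

Lemma cvg_invn : (n%:R^-1 : R) @[n --> \oo] --> (0 : R).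
Proof.
by rewrite -(cvg_shiftS (fun n => n%:R^-1 : R)); exact: cvg_harmonic.
Qed.

(** For a sequence of polynomial growth, [1 + u_n^2 <= (3 n)^4] eventually, so
    [ln (1 + u_n^2) <= 8 ln (sqrt (3 n)) <= 8 sqrt (3 n) = o(n)]. *)
Lemma cvg_log_growth (u : nat -> R) :
  (\forall n \near \oo, `|u n| <= n.+1%:R * n.+2%:R) ->
  (n%:R^-1 * ln (1 + u n ^+ 2)) @[n --> \oo] --> (0 : R).
Proof.
move=> hu.
have lim : (8 * Num.sqrt (3 * n%:R^-1)) @[n --> \oo] --> (0 : R).
  rewrite -[X in _ --> X](mulr0 8); apply: cvgMl_tmp.
  rewrite -[X in _ --> X](@sqrtr0 R); apply: continuous_cvg.
    exact: sqrt_continuous.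
  rewrite -[X in _ --> X](mulr0 3); apply: cvgMl_tmp.
  exact: cvg_invn.
apply: (squeeze_cvgr _ (cvg_cst 0) lim).
near=> n.
have n1 : 1 <= n%:R :> R by rewrite ler1n; near: n; exact: nbhs_infty_ge.
have n0 : 0 < n%:R :> R by exact: lt_le_trans n1.
have : `|u n| <= n.+1%:R * n.+2%:R by near: n.
rewrite -[n.+2]addn1 -[n.+1]addn1 !natrD => un.
have u2 : 1 + u n ^+ 2 <= (3 * n%:R) ^+ 4.
  have un6 : `|u n| <= 6 * n%:R ^+ 2 by nra.
  have : u n ^+ 2 <= (6 * n%:R ^+ 2) ^+ 2.
    by rewrite -real_normK ?num_real// lerXn2r// nnegrE// mulr_ge0// sqr_ge0.
  have : 1 <= n%:R ^+ 4 :> R by rewrite exprn_ege1.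
  move=> *; lra.
have n3 : 0 < 3 * n%:R :> R by rewrite mulr_gt0.
apply/andP; split.
  by rewrite mulr_ge0 ?invr_ge0 ?(ltW n0)// ln_ge0// lerDl sqr_ge0.
have -> : 8 * Num.sqrt (3 * n%:R^-1) = n%:R^-1 * (8 * Num.sqrt (3 * n%:R)) :> R.
  have -> : 3 * n%:R^-1 = n%:R^-1 ^+ 2 * (3 * n%:R) :> R by field; exact: lt0r_neq0.
  by rewrite [in LHS]sqrtrM ?sqr_ge0// sqrtr_sqr ger0_norm ?invr_ge0 ?(ltW n0)// mulrCA.
rewrite ler_pM2l ?invr_gt0//.
apply: (@le_trans _ _ (ln ((3 * n%:R) ^+ 4))).
  by rewrite ler_ln ?posrE ?oneDsqr_gt0// exprn_gt0.
rewrite -{1}[3 * n%:R]sqr_sqrtr ?(ltW n3)// -exprM lnXn ?sqrtr_gt0//.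
rewrite -[(2 * 4)%N]/8%N -[leLHS]mulr_natl ler_pM2l// ltW// ln_sublinear// sqrtr_gt0//.
Unshelve. all: by end_near. Qed.

Lemma sum_ln_derive_affine_boole (a b x : R) (n : nat) : b != 0 ->
  (forall k, iter k boole ((x - a) / b) != 0) ->
  \sum_(0 <= k < n) ln `|derive1 (affine_boole a b) (iter k (affine_boole a b) x)|
  = n%:R * ln 2 + ln (1 + iter n boole ((x - a) / b) ^+ 2)
    - ln (1 + ((x - a) / b) ^+ 2).
Proof.
move=> b0 orb; set y := (x - a) / b in orb *.
pose L k := ln (1 + iter k boole y ^+ 2).
transitivity (\sum_(0 <= k < n) (ln 2 + (L k.+1 - L k))).
  apply: eq_bigr => k _.
  have xk := iter_affine_boole_neq a b x k b0 (orb k).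
  have dk := is_derive_affine_boole a b _ b0 xk.
  rewrite derive1E derive_val iter_affine_boole// -/y /L -iterS.
  set p := 1 + iter k.+1 _ _ ^+ 2; set q := 1 + iter k _ _ ^+ 2.
  have p0 : 0 < p by exact: oneDsqr_gt0.
  have q0 : 0 < q by exact: oneDsqr_gt0.
  rewrite gtr0_norm ?divr_gt0 ?mulr_gt0// ln_div ?posrE ?mulr_gt0//.
  by rewrite lnM ?posrE// addrA.
rewrite big_split/= telescope_sumr// sumr_const_nat subn0 mulr_natl addrA.
by [].
Qed.

End lyapunov.

Theorem theorem1p4 (R : realType) (a b : R) (hb : 0 < b) :
  {ae (@lebesgue_measure R), forall x0 : R,
     is_lyapunov_exponent (affine_boole a b) x0 (ln 2)}.
Proof.
have b0 := lt0r_neq0 hb.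
have diff : ae_differentiable (affine_boole a b).
  exists [set a]; split => //; first exact: lebesgue_measure_set1.
  move=> x /= nd; apply: contrapT => /eqP xa; apply: nd.
  by have [] := is_derive_affine_boole a b x b0 xa.
have ae0 := ae_affine a b _ hb ae_iter_boole_neq0.
have aeG := ae_affine a b _ hb ae_iter_boole_growth.
apply: (@filterS2 _ _ (ae_filter_ringOfSetsType (@lebesgue_measure R)) _ _ _ _
  ae0 aeG) => x orb growth.
split => // [k|].
  have xk := iter_affine_boole_neq a b x k b0 (orb k).
  have dk := is_derive_affine_boole a b _ b0 xk.
  split; first by have [] := dk.
  by rewrite derive1E derive_val !mulf_neq0 ?invr_eq0 ?oneDsqr_neq0.
set y := (x - a) / b in orb growth.
have lim : (ln 2 + (n%:R^-1 * ln (1 + iter n boole y ^+ 2)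
    - n%:R^-1 * ln (1 + y ^+ 2))) @[n --> \oo] --> (ln 2 : R).
  rewrite -[X in _ --> X]addr0; apply: cvgD; first exact: cvg_cst.
  rewrite -[X in _ --> X](subr0 0); apply: cvgB; first exact: cvg_log_growth.
  rewrite -[X in _ --> X](mul0r (ln (1 + y ^+ 2))); apply: cvgMr_tmp.
  exact: cvg_invn.
apply: cvg_trans lim; apply: near_eq_cvg; near=> n.
have n0 : n%:R != 0 :> R.
  by rewrite pnatr_eq0 -lt0n; near: n; exact: nbhs_infty_gt.
rewrite sum_ln_derive_affine_boole//.
by rewrite -/y mulrBr mulrDr mulKf// addrA.
Unshelve. all: by end_near. Qed.
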